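(* Let $n>0$ and $0\le m\le n-1$ be integers. Let $t_1<\dots<t_n$ be the roots of $\psi_n$ in $(-1,1)$ and $W_j=\frac{1}{\psi_n'(t_j)}\int_{-1}^1\frac{\psi_n(s)\,ds}{s-t_j}$. Define $\Psi_n(y,t)=\int_0^y\psi_n(x)e^{-icxt}\,dx$ and $$P_{n,m}=\sum_{j=1}^n\frac{\psi_m(t_j)}{\psi_n'(t_j)}\Psi_n(1,t_j).$$ Let $I(t)=\frac{1}{\psi_n(t)}-\sum_{j=1}^n\frac{1}{\psi_n'(t_j)(t-t_j)}$ for $t\in(-1,1)$ and $\|I\|_\infty=\sup\{|I(t)|:-1<t<1\}$. Then $$\Big|\int_{-1}^1\psi_m(s)\,ds-\sum_{j=1}^n\psi_m(t_j)W_j\Big|\le\Big(1-\frac{|\lambda_n|^2}{|\lambda_m|^2}\Big)\|I\|_\infty+|\lambda_n|\Big(\frac{|\lambda_n|}{|\lambda_m|}|\psi_m(0)|+c|P_{n,m}|\Big).$$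
   Context: For a real number $c>0$, let $F_c[\varphi](x)=\int_{-1}^1\varphi(t)e^{icxt}\,dt$ on $L^2[-1,1]$, with eigenvalues $\lambda_0,\lambda_1,\dots$ ordered so that $|\lambda_n|\ge|\lambda_{n+1}|$ (nonzero, simple, $\lambda_n=i^n|\lambda_n|$) and corresponding real eigenfunctions $\psi_0,\psi_1,\dots$ (prolate spheroidal wave functions) with $\|\psi_n\|_{L^2[-1,1]}=1$, forming an orthonormal basis of $L^2[-1,1]$; $\psi_n$ has the parity of $n$ and exactly $n$ simple roots in $(-1,1)$. Each $\psi_n$ extends to an entire function via $\lambda_n\psi_n(x)=\int_{-1}^1\psi_n(t)e^{icxt}\,dt$. *)

(* Defs.v *)
From Stdlib Require Import Reals.
From Coquelicot Require Import Coquelicot.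
Open Scope R_scope.

Definition cis (th : R) : C := (cos th, sin th).

Fixpoint rsum (n : nat) (f : nat -> R) : R :=
  match n with O => 0 | S k => rsum k f + f k end.
Fixpoint csum (n : nat) (f : nat -> C) : C :=
  match n with O => RtoC 0 | S k => Cplus (csum k f) (f k) end.

Definition Fc (c : R) (phi : R -> R) (x : R) : C :=
  @RInt C_R_CompleteNormedModule (fun t => Cmult (RtoC (phi t)) (cis (c * x * t))) (-1) 1.

(* (lam, psi) is the system of eigenvalues / real L^2-normalized eigenfunctions of F_c
   (prolate spheroidal wave functions), ordered by decreasing |lam_n|, forming an
   orthonormal basis of L^2[-1,1]; psi n is the entire extension restricted to R. *)
Definition is_PSWF_system (c : R) (lam : nat -> C) (psi : nat -> R -> R) : Prop :=
  (forall k x, continuous (psi k) x) /\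
  (forall k, lam k <> RtoC 0) /\
  (forall k x, Cmult (lam k) (RtoC (psi k x)) = Fc c (psi k) x) /\
  (forall k l, RInt (fun s => psi k s * psi l s) (-1) 1 = if Nat.eqb k l then 1 else 0) /\
  (forall f : R -> R, (forall x, continuous f x) ->
     (forall k, RInt (fun s => f s * psi k s) (-1) 1 = 0) ->
     forall x, -1 <= x <= 1 -> f x = 0) /\
  (forall k, Cmod (lam (S k)) <= Cmod (lam k)).

(* Main.v *)
Require Import Defs.
From Stdlib Require Import Reals Lra Lia.
From Coquelicot Require Import Coquelicot.
Open Scope R_scope.

(** Fix a root [tau] of [psi_n] and let [q t = psi_n t / (t - tau)], extended continuously.
    The function [H x = e^{ic tau x} int_1^x psi_n(s) e^{-ic tau s} ds] vanishes at [1] and,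
    because [psi_n tau = 0], also at [-1]; integrating [(H e^{-icts})'] by parts gives
    [conj lam_n * q t = ic int_{-1}^1 H(s) e^{-icts} ds].  Conversely the transform
    [Q x = int_{-1}^1 q(t) e^{icxt} dt] solves [Q' - ic tau Q = ic lam_n psi_n], so that
    [Q x = ic lam_n H x + K e^{ic tau x}] with [K = int q + ic lam_n Psi_n(1, tau)].
    Pairing both identities with [psi_m] and using the symmetry of the transform gives
    [(1 - |lam_n|^2 / |lam_m|^2) int q psi_m = K psi_m tau].  Summing over the roots with
    weights [1 / psi_n'(t_j)], the quadrature error equals
    [(1 - r^2) int I psi_m psi_n + r^2 int psi_m + ic lam_n P] with [r = |lam_n| / |lam_m|],
    and [int psi_m = lam_m psi_m(0)].  The identity is linear in the weights, hence
    covers the junk weight [/ 0 = 0] that a multiple root would carry. *)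

(** * Parameter integrals and Fubini's theorem for jointly continuous real kernels *)

Lemma ex_RInt_cont (f : R -> R) (a b : R) :
  (forall x, continuous f x) -> ex_RInt f a b.
Proof. intros Hf; apply (ex_RInt_continuous (V := R_CompleteNormedModule)); auto. Qed.

Lemma continuity_2d_pt_section (k : R -> R -> R) (x y : R) :
  continuity_2d_pt k x y -> continuous (k x) y.
Proof.
  intros H. apply continuity_pt_filterlim. 
  intros eps Heps. destruct (H (mkposreal eps Heps)) as [d Hd].
  exists d; split; [apply cond_pos|]. intros z [_ Hz].
  apply (Hd x z); [rewrite Rminus_eq_0, Rabs_R0; apply cond_pos | exact Hz].
Qed.

Lemma continuity_2d_pt_swap (k : R -> R -> R) (x y : R) :
  continuity_2d_pt k x y -> continuity_2d_pt (fun u v => k v u) y x.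
Proof.
  intros H eps. destruct (H eps) as [d Hd]. exists d; intros u v Hu Hv; apply Hd; auto.
Qed.

(** Joint continuity is uniform in [v] over the compact integration interval, so the integrands at
    nearby parameters differ by a uniformly small amount. *)
Lemma continuous_RInt_param (k : R -> R -> R) (a b x : R) :
  (forall u v, continuity_2d_pt k u v) ->
  continuous (fun u => RInt (k u) a b) x.
Proof.
  intros Hk. apply continuity_pt_filterlim. intros eps Heps.
  (* The added 1 keeps [M] positive when [a = b] and makes the final inequality strict. *)
  set (M := Rabs (b - a) + 1).
  assert (HM : 0 < M) by (unfold M; pose proof (Rabs_pos (b - a)); lra).
  assert (He : 0 < eps / M) by (apply Rdiv_lt_0_compat; lra).
  destruct (uniform_continuity_2d_1d' k (Rmin a b) (Rmax a b) x
              (fun v _ => Hk x v) (mkposreal _ He)) as [d Hd].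
  exists d; split; [apply cond_pos|]. intros z [_ Hz].
  assert (Hi : forall u, ex_RInt (k u) a b)
    by (intros u; apply ex_RInt_cont; intros; apply continuity_2d_pt_section; auto).
  change (Rabs (RInt (k z) a b - RInt (k x) a b) < eps).
  change (Rabs (z - x) < d) in Hz.
  pose proof (RInt_minus (k z) (k x) a b (Hi z) (Hi x)) as E.
  change (RInt (fun v => k z v - k x v) a b = RInt (k z) a b - RInt (k x) a b) in E.
  rewrite <- E.
  apply Rle_lt_trans with (Rabs (b - a) * (eps / M)).
  - apply (norm_RInt_le_const_abs (V := R_NormedModule) (fun v => k z v - k x v) a b).
    + intros v Hv. apply Rlt_le. apply Rabs_def2 in Hz.
      apply (Hd v x v z); auto; try lra.
      rewrite Rminus_eq_0, Rabs_R0; apply cond_pos.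
    + apply (RInt_correct (V := R_CompleteNormedModule)), (ex_RInt_minus (V := R_NormedModule)); auto.
  - replace eps with (M * (eps / M)) at 2 by (field; lra).
    apply Rmult_lt_compat_r; auto. unfold M; lra.
Qed.

Lemma is_derive_zero_const (f : R -> R) (x y : R) :
  (forall z, is_derive f z 0) -> f x = f y.
Proof.
  intros H. destruct (Rtotal_order x y) as [h|[h|h]]; [ | now subst | symmetry];
  apply (eq_is_derive f); auto; intros; apply H.
Qed.

(** As functions of the upper limit [b], both iterated integrals vanish at [b = a] and have the same
    derivative; hence they agree, whatever the order of the limits. *)
Lemma RInt_fubini (k : R -> R -> R) (a b c d : R) :
  (forall u v, continuity_2d_pt k u v) ->
  RInt (fun x => RInt (k x) a b) c d = RInt (fun y => RInt (fun x => k x y) c d) a b.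
Proof.
  intros Hk.
  assert (Hk' : forall u v, continuity_2d_pt (fun y x => k x y) u v)
    by (intros; apply continuity_2d_pt_swap; auto).
  assert (Hc : forall y, continuous (fun y => RInt (fun x => k x y) c d) y)
    by (intros; apply (continuous_RInt_param (fun y x => k x y)); auto).
  assert (Hk1 : forall x y, continuous (k x) y) by (intros; apply continuity_2d_pt_section; auto).
  set (F := fun z => RInt (fun x => RInt (k x) a z) c d -
                     RInt (fun y => RInt (fun x => k x y) c d) a z).
  assert (HD : forall x z, is_derive (fun z => RInt (k x) a z) z (k x z)).
  { intros x z. apply (is_derive_RInt (k x) _ a); auto.
    apply filter_forall; intros. apply (RInt_correct (V := R_CompleteNormedModule)), ex_RInt_cont; auto. }
  assert (HF : forall z, is_derive F z 0).
  { intros z. unfold F.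
    replace 0 with (RInt (fun x => k x z) c d - RInt (fun x => k x z) c d) by ring.
    apply @is_derive_minus.
    (* The left integral is differentiated under the integral sign; the partial derivative in the
       upper limit is [k x z] by [HD]. *)
    - replace (RInt (fun x => k x z) c d)
        with (RInt (fun x => Derive (fun u => RInt (k x) a u) z) c d)
        by (apply RInt_ext; intros; apply is_derive_unique; auto).
      apply (is_derive_RInt_param (fun u x => RInt (k x) a u) c d z).
      + apply filter_forall; intros z' x _. eexists; apply HD.
      + intros x _. apply continuity_2d_pt_ext with (fun y x => k x y); auto.
        intros; symmetry; apply is_derive_unique; auto.
      + apply filter_forall; intros y. apply ex_RInt_cont. intros x.
        apply continuous_RInt_param; auto.
    - apply (is_derive_RInt (fun y => RInt (fun x => k x y) c d) _ a); auto.
      apply filter_forall; intros. apply (RInt_correct (V := R_CompleteNormedModule)), ex_RInt_cont; auto. }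
  assert (E : F b = F a) by (apply is_derive_zero_const; auto).
  unfold F in E. rewrite (RInt_point a (fun y => RInt (fun x => k x y) c d)) in E.
  rewrite (RInt_ext (fun x => RInt (k x) a a) (fun _ => 0)) in E
    by (intros; apply (RInt_point a (k _))).
  rewrite RInt_const in E. unfold scal, zero in E; simpl in E; unfold mult in E; simpl in E. lra.
Qed.

(** * Componentwise calculus for complex functions of a real variable *)

Ltac Rring := match goal with |- @eq _ ?a ?b => change (@eq R a b) end; unfold Re, Im; simpl; ring.

(** Continuity, integral and derivative are encoded through real and imaginary parts, so that real
    calculus applies to each component. *)
Definition Ccont (f : R -> C) : Prop :=
  forall x, continuous (fun u => Re (f u)) x /\ continuous (fun u => Im (f u)) x.
Definition CInt (f : R -> C) (a b : R) : C :=
  (RInt (fun u => Re (f u)) a b, RInt (fun u => Im (f u)) a b).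
Definition Cderiv (f : R -> C) (x : R) (l : C) : Prop :=
  is_derive (fun u => Re (f u)) x (Re l) /\ is_derive (fun u => Im (f u)) x (Im l).

(** Bridges the complex-valued integral in [Fc] and in the theorem to the componentwise one used in
    the proof. *)
Lemma RInt_C_CInt (f : R -> C) (a b : R) :
  Ccont f -> @RInt C_R_CompleteNormedModule f a b = CInt f a b.
Proof.
  intros Hf. apply @is_RInt_unique.
  apply (is_RInt_fct_extend_pair (U := R_NormedModule) (V := R_NormedModule) f);
    apply (RInt_correct (V := R_CompleteNormedModule)), ex_RInt_cont; intros x; apply (Hf x).
Qed.

Lemma Ccont_RtoC (f : R -> R) : (forall x, continuous f x) -> Ccont (fun x => RtoC (f x)).
Proof. intros Hf x; split; [apply Hf | apply continuous_const]. Qed.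

Lemma Ccont_const (k : C) : Ccont (fun _ => k).
Proof. intros x; split; apply continuous_const. Qed.

Lemma Ccont_cis (w : R) : Ccont (fun x => cis (w * x)).
Proof.
  intros x; split; simpl;
  [apply continuous_cos_comp | apply continuous_sin_comp];
  apply (continuous_mult (fun _ => w) (fun u => u));
  (apply continuous_const || apply continuous_id).
Qed.

Lemma Ccont_plus (f g : R -> C) : Ccont f -> Ccont g -> Ccont (fun x => Cplus (f x) (g x)).
Proof.
  intros Hf Hg x; destruct (Hf x), (Hg x); split; simpl;
  apply (continuous_plus (V := R_NormedModule)); auto.
Qed.

Lemma Ccont_mult (f g : R -> C) : Ccont f -> Ccont g -> Ccont (fun x => Cmult (f x) (g x)).
Proof.
  intros Hf Hg x; destruct (Hf x), (Hg x); split; simpl;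
  [apply (continuous_minus (V := R_NormedModule)) | apply (continuous_plus (V := R_NormedModule))];
  apply (continuous_mult (K := R_AbsRing)); auto.
Qed.

Lemma Ccont_ext (f g : R -> C) : (forall x, f x = g x) -> Ccont f -> Ccont g.
Proof.
  intros E Hf x; destruct (Hf x); split;
  [apply (continuous_ext (fun u => Re (f u))) | apply (continuous_ext (fun u => Im (f u)))];
  auto; intros; rewrite E; reflexivity.
Qed.

Lemma CInt_ext (f g : R -> C) (a b : R) : (forall x, f x = g x) -> CInt f a b = CInt g a b.
Proof.
  intros E; unfold CInt; f_equal; apply RInt_ext; intros; rewrite E; reflexivity.
Qed.

Lemma CInt_point (f : R -> C) (a : R) : CInt f a a = RtoC 0.
Proof. unfold CInt; rewrite !RInt_point; reflexivity. Qed.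

Lemma CInt_Chasles (f : R -> C) (a b c : R) :
  Ccont f -> Cplus (CInt f a b) (CInt f b c) = CInt f a c.
Proof.
  intros Hf; unfold CInt, Cplus; simpl; f_equal;
  apply (RInt_Chasles (V := R_CompleteNormedModule)); apply ex_RInt_cont; intros x; apply (Hf x).
Qed.

Lemma CInt_plus (f g : R -> C) (a b : R) :
  Ccont f -> Ccont g ->
  CInt (fun x => Cplus (f x) (g x)) a b = Cplus (CInt f a b) (CInt g a b).
Proof.
  intros Hf Hg; unfold CInt, Cplus; simpl; f_equal;
  apply (RInt_plus (V := R_CompleteNormedModule)); apply ex_RInt_cont; intros x;
  (apply (Hf x) || apply (Hg x)).
Qed.

Lemma CInt_conj (f : R -> C) (a b : R) :
  Ccont f -> CInt (fun x => Cconj (f x)) a b = Cconj (CInt f a b).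
Proof.
  intros Hf; unfold CInt, Cconj; simpl; f_equal.
  apply (RInt_opp (V := R_CompleteNormedModule)); apply ex_RInt_cont; intros x; apply (Hf x).
Qed.

Lemma CInt_mult_l (k : C) (f : R -> C) (a b : R) :
  Ccont f -> CInt (fun x => Cmult k (f x)) a b = Cmult k (CInt f a b).
Proof.
  intros Hf.
  assert (ER : forall u v g h, (forall x, continuous g x) -> (forall x, continuous h x) ->
    RInt (fun x => u * g x + v * h x) a b = u * RInt g a b + v * RInt h a b).
  { intros u v g h Hg Hh.
    assert (E := RInt_plus (V := R_CompleteNormedModule)
      (fun x => scal u (g x)) (fun x => scal v (h x)) a b).
    rewrite !(RInt_scal (V := R_CompleteNormedModule)) in E by (apply ex_RInt_cont; auto).
    apply E; apply @ex_RInt_scal, ex_RInt_cont; auto. }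
  destruct k as [u v]. unfold CInt, Cmult; simpl; f_equal.
  - rewrite (RInt_ext _ (fun x => u * Re (f x) + (- v) * Im (f x)))
      by (intros; Rring).
    rewrite ER; [Rring | |]; intros x; apply (Hf x).
  - rewrite (RInt_ext _ (fun x => v * Re (f x) + u * Im (f x)))
      by (intros; Rring).
    rewrite ER; [Rring | |]; intros x; apply (Hf x).
Qed.

Lemma CInt_RtoC (f : R -> R) (a b : R) : CInt (fun x => RtoC (f x)) a b = RtoC (RInt f a b).
Proof.
  unfold CInt, RtoC; simpl; f_equal.
  rewrite RInt_const. unfold scal; simpl; unfold mult; simpl; ring.
Qed.

Lemma Cderiv_Ccont (f : R -> C) : (forall x, exists l, Cderiv f x l) -> Ccont f.
Proof.
  intros H x; destruct (H x) as [l [H1 H2]]; split; apply @ex_derive_continuous; eexists; eassumption.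
Qed.

Lemma Cderiv_mult (f g : R -> C) (x : R) (df dg : C) :
  Cderiv f x df -> Cderiv g x dg ->
  Cderiv (fun u => Cmult (f u) (g u)) x (Cplus (Cmult df (g x)) (Cmult (f x) dg)).
Proof.
  intros [F1 F2] [G1 G2].
  assert (M : forall a b x da db, is_derive a x da -> is_derive b x db ->
     is_derive (fun u => a u * b u) x (da * b x + a x * db))
   by (intros; apply (is_derive_mult a b); auto; intros; apply Rmult_comm).
  split; simpl.
  - pose proof (is_derive_minus _ _ _ _ _ (M _ _ _ _ _ F1 G1) (M _ _ _ _ _ F2 G2)) as E.
    eapply is_derive_ext; [|evar_last; [exact E|]].
    + intros; reflexivity.
    + unfold minus, plus, opp, Re, Im; simpl; ring.
  - pose proof (is_derive_plus _ _ _ _ _ (M _ _ _ _ _ F1 G2) (M _ _ _ _ _ F2 G1)) as E.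
    eapply is_derive_ext; [|evar_last; [exact E|]].
    + intros; reflexivity.
    + unfold minus, plus, opp, Re, Im; simpl; ring.
Qed.

Lemma Cderiv_cis (w x : R) : Cderiv (fun u => cis (w * u)) x (Cmult (0, w) (cis (w * x))).
Proof. split; simpl; auto_derive; auto; ring. Qed.

Lemma Cderiv_CInt (f : R -> C) (a x : R) : Ccont f -> Cderiv (fun u => CInt f a u) x (f x).
Proof.
  intros Hf; split; simpl;
  [apply (is_derive_RInt (fun u => Re (f u)) _ a) | apply (is_derive_RInt (fun u => Im (f u)) _ a)];
  try apply (Hf x); apply filter_forall; intros;
  apply (RInt_correct (V := R_CompleteNormedModule)), ex_RInt_cont; intros y; apply (Hf y).
Qed.

Lemma CInt_Cderiv (f df : R -> C) (a b : R) :
  (forall x, Cderiv f x (df x)) -> Ccont df -> CInt df a b = Cminus (f b) (f a).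
Proof.
  intros Hf Hd. unfold CInt, Cminus, Cplus, Copp; simpl.
  f_equal; apply is_RInt_unique; 
  [apply (is_RInt_derive (V := R_CompleteNormedModule) (fun u => Re (f u)))
  |apply (is_RInt_derive (V := R_CompleteNormedModule) (fun u => Im (f u)))]; intros x _; first [apply (Hf x)|apply (Hd x)].
Qed.

Lemma CInt_fubini (k : R -> R -> C) (a b c d : R) :
  (forall u v, continuity_2d_pt (fun x y => Re (k x y)) u v) ->
  (forall u v, continuity_2d_pt (fun x y => Im (k x y)) u v) ->
  CInt (fun x => CInt (k x) a b) c d = CInt (fun y => CInt (fun x => k x y) c d) a b.
Proof.
  intros H1 H2; unfold CInt; simpl; f_equal;
  [apply (RInt_fubini (fun x y => Re (k x y)))|apply (RInt_fubini (fun x y => Im (k x y)))]; auto.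
Qed.

(** * The finite Fourier transform: symmetry and differentiation *)

Lemma continuity_2d_pt_trig (w x y : R) :
  continuity_2d_pt (fun u v => cos (w * u * v)) x y /\
  continuity_2d_pt (fun u v => sin (w * u * v)) x y.
Proof.
  assert (continuity_2d_pt (fun u v => w * u * v) x y)
    by (repeat apply continuity_2d_pt_mult; (apply continuity_2d_pt_const ||
        apply continuity_2d_pt_id1 || apply continuity_2d_pt_id2)).
  split; [apply (continuity_1d_2d_pt_comp cos) | apply (continuity_1d_2d_pt_comp sin)]; auto;
  [apply continuity_cos | apply continuity_sin].
Qed.

(** Joint continuity is what both Fubini and differentiation under the integral sign require of the
    Fourier kernel. *)
Lemma continuity_2d_pt_kernel (f g : R -> C) (w x y : R) :
  Ccont f -> Ccont g ->
  continuity_2d_pt (fun u v => Re (Cmult (f u) (Cmult (g v) (cis (w * u * v))))) x y /\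
  continuity_2d_pt (fun u v => Im (Cmult (f u) (Cmult (g v) (cis (w * u * v))))) x y.
Proof.
  intros Hf Hg. destruct (continuity_2d_pt_trig w x y) as [Hcos Hsin].
  destruct (Hf x) as [F1 F2], (Hg y) as [G1 G2].
  assert (L : forall h u v, continuous h u -> continuity_2d_pt (fun x _ => h x) u v)
   by (intros h u v Hh; apply (continuity_1d_2d_pt_comp h (fun x _ => x));
       [apply continuity_pt_filterlim, Hh | apply continuity_2d_pt_id1]).
  assert (L' : forall h u v, continuous h v -> continuity_2d_pt (fun _ y => h y) u v)
   by (intros h u v Hh; apply (continuity_1d_2d_pt_comp h (fun _ y => y));
       [apply continuity_pt_filterlim, Hh | apply continuity_2d_pt_id2]).
  pose proof (L _ x y F1). pose proof (L _ x y F2).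
  pose proof (L' _ x y G1). pose proof (L' _ x y G2).
  unfold Re, Im in *.
  split; simpl; repeat first [assumption
   | apply continuity_2d_pt_minus | apply continuity_2d_pt_plus | apply continuity_2d_pt_mult].
Qed.

(** The frequency is a parameter because both signs occur: [c] gives the transform of the theorem,
    [- c] its adjoint. *)
Definition cfourier (w : R) (g : R -> C) (x : R) : C :=
  CInt (fun y => Cmult (g y) (cis (w * x * y))) (-1) 1.

Lemma cfourier_integrand_cont (w : R) (g : R -> C) (x : R) :
  Ccont g -> Ccont (fun y => Cmult (g y) (cis (w * x * y))).
Proof. intros; apply Ccont_mult; auto. apply Ccont_cis. Qed.

(** The kernel depends only on the product of [x] and [y], so exchanging the integrations exchanges
    [f] and [g]. *)
Lemma cfourier_symm (w : R) (f g : R -> C) :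
  Ccont f -> Ccont g ->
  CInt (fun x => Cmult (f x) (cfourier w g x)) (-1) 1 = CInt (fun y => Cmult (g y) (cfourier w f y)) (-1) 1.
Proof.
  intros Hf Hg. unfold cfourier.
  rewrite (CInt_ext _ (fun x => CInt (fun y => Cmult (f x) (Cmult (g y) (cis (w * x * y)))) (-1) 1))
    by (intros; symmetry; apply CInt_mult_l, cfourier_integrand_cont; auto).
  rewrite CInt_fubini by (intros; apply continuity_2d_pt_kernel; auto).
  apply CInt_ext; intros y. rewrite <- CInt_mult_l by (apply cfourier_integrand_cont; auto).
  apply CInt_ext; intros x. replace (w * y * x) with (w * x * y) by ring. ring.
Qed.

Lemma Cderiv_cfourier (w : R) (g : R -> C) (x : R) :
  Ccont g -> Cderiv (cfourier w g) x (cfourier w (fun y => Cmult (0, w * y) (g y)) x).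
Proof.
  intros Hg.
  (* The real Leibniz rule, stated once and applied to both components. *)
  assert (R0 : forall (k dk : R -> R -> R), (forall u v, is_derive (fun z => k z v) u (dk u v)) ->
     (forall u v, continuity_2d_pt dk u v) -> (forall u v, continuous (k u) v) ->
     is_derive (fun u => RInt (k u) (-1) 1) x (RInt (dk x) (-1) 1)).
  { intros k dk H1 H2 H3.
    rewrite <- (RInt_ext (fun v => Derive (fun z => k z v) x)) by (intros; apply is_derive_unique, H1).
    apply (is_derive_RInt_param k (-1) 1 x).
    - apply filter_forall; intros; eexists; apply H1.
    - intros v _. apply continuity_2d_pt_ext with dk; auto.
      intros; symmetry; apply is_derive_unique, H1.
    - apply filter_forall; intros; apply ex_RInt_cont; auto. }
  assert (Hg' : Ccont (fun y => Cmult (0, w * y) (g y))).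
  { apply Ccont_mult; auto. intros y; split; simpl; [apply continuous_const|].
    apply (continuous_mult (fun _ => w) (fun u => u)); (apply continuous_const || apply continuous_id). }
  (* Taking the outer factor equal to 1 gives the joint continuity of the differentiated
     integrand. *)
  pose proof (fun u v => continuity_2d_pt_kernel (fun _ => RtoC 1) _ w u v (Ccont_const _) Hg') as HK.
  split; unfold cfourier, CInt;
  [apply (R0 (fun u y => Re (Cmult (g y) (cis (w * u * y)))) (fun u y => Re (Cmult (Cmult (0, w * y) (g y)) (cis (w * u * y)))))
  |apply (R0 (fun u y => Im (Cmult (g y) (cis (w * u * y)))) (fun u y => Im (Cmult (Cmult (0, w * y) (g y)) (cis (w * u * y)))))];
  try (intros u v; apply (cfourier_integrand_cont w g u Hg v)).
  - intros u v; simpl; auto_derive; auto; ring.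
  - intros u v; eapply continuity_2d_pt_ext; [|apply (proj1 (HK u v))]. intros; simpl; ring.
  - intros u v; simpl; auto_derive; auto; ring.
  - intros u v; eapply continuity_2d_pt_ext; [|apply (proj2 (HK u v))]. intros; simpl; ring.
Qed.

Lemma Ccont_cfourier (w : R) (g : R -> C) : Ccont g -> Ccont (cfourier w g).
Proof. intros Hg; apply Cderiv_Ccont; intros x; eexists; apply Cderiv_cfourier, Hg. Qed.

(** * Identities for the unit exponential and further rules for complex derivatives *)

Lemma cis_0 : cis 0 = RtoC 1.
Proof. unfold cis; rewrite cos_0, sin_0; reflexivity. Qed.

Lemma cis_opp_l (a : R) : Cmult (cis (- a)) (cis a) = RtoC 1.
Proof.
  unfold cis, Cmult, RtoC; simpl. rewrite cos_neg, sin_neg.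
  pose proof (sin2_cos2 a) as E; unfold Rsqr in E. f_equal; lra.
Qed.

Lemma Cconj_cis (a : R) : Cconj (cis a) = cis (- a).
Proof. unfold cis, Cconj; simpl. rewrite cos_neg, sin_neg; reflexivity. Qed.

Lemma Cmod_sqr_conj (z : C) : Cmult z (Cconj z) = RtoC (Cmod z ^ 2).
Proof.
  unfold Cmod. rewrite pow2_sqrt by nra.
  destruct z; unfold Cmult, Cconj, RtoC; simpl; f_equal; ring.
Qed.

Lemma Cderiv_eq (f : R -> C) (x : R) (l l' : C) : l = l' -> Cderiv f x l -> Cderiv f x l'.
Proof. intros ->; auto. Qed.

Lemma Cderiv_plus (f g : R -> C) (x : R) (df dg : C) :
  Cderiv f x df -> Cderiv g x dg -> Cderiv (fun u => Cplus (f u) (g u)) x (Cplus df dg).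
Proof.
  intros [F1 F2] [G1 G2]; split; simpl; [apply (is_derive_plus _ _ _ _ _ F1 G1) | apply (is_derive_plus _ _ _ _ _ F2 G2)].
Qed.

Lemma Cderiv_const (k : C) (x : R) : Cderiv (fun _ => k) x (RtoC 0).
Proof. split; apply @is_derive_const. Qed.

Lemma Cderiv_zero_const (f : R -> C) (x y : R) :
  (forall z, Cderiv f z (RtoC 0)) -> f x = f y.
Proof.
  intros H. apply injective_projections;
  [apply (is_derive_zero_const (fun u => Re (f u))) | apply (is_derive_zero_const (fun u => Im (f u)))];
  intros z; apply (H z).
Qed.

(** * The quotient of an eigenfunction by a linear factor at a root, and its transform *)

Lemma cfourier_conj (c : R) (psi : R -> R) (lam : C) :
  (forall x, continuous psi x) ->
  (forall x, Cmult lam (RtoC (psi x)) = cfourier c (fun t => RtoC (psi t)) x) ->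
  forall x, Cmult (Cconj lam) (RtoC (psi x)) = cfourier (- c) (fun t => RtoC (psi t)) x.
Proof.
  intros Hc He x. 
  transitivity (Cconj (Cmult lam (RtoC (psi x)))).
  { unfold Cmult, Cconj, RtoC; simpl; f_equal; ring. }
  rewrite He. unfold cfourier. rewrite <- CInt_conj by (apply cfourier_integrand_cont, Ccont_RtoC; auto).
  apply CInt_ext; intros t.
  transitivity (Cmult (RtoC (psi t)) (Cconj (cis (c * x * t)))).
  { unfold Cmult, Cconj, RtoC; simpl; f_equal; ring. }
  rewrite Cconj_cis. do 2 f_equal. ring.
Qed.

(* The solution of [H' = i c tau H + psi] with [H 1 = 0]. *)
Definition duhamel (c : R) (psi : R -> R) (tau x : R) : C :=
  Cmult (cis (c * tau * x)) (CInt (fun s => Cmult (RtoC (psi s)) (cis (- c * tau * s))) 1 x).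

Lemma Cderiv_duhamel (c : R) (psi : R -> R) (tau x : R) :
  (forall x, continuous psi x) ->
  Cderiv (duhamel c psi tau) x (Cplus (Cmult (0, c * tau) (duhamel c psi tau x)) (RtoC (psi x))).
Proof.
  intros Hc. eapply Cderiv_eq; [| apply Cderiv_mult; [apply Cderiv_cis |
   apply Cderiv_CInt, cfourier_integrand_cont, Ccont_RtoC; auto]].
  unfold duhamel. replace (- c * tau * x) with (- (c * tau * x)) by ring.
  rewrite <- (Cmult_1_r (RtoC (psi x))) at 2. rewrite <- (cis_opp_l (c * tau * x)). ring.
Qed.

Lemma Ccont_duhamel (c : R) (psi : R -> R) (tau : R) :
  (forall x, continuous psi x) -> Ccont (duhamel c psi tau).
Proof. intros Hc; apply Cderiv_Ccont; intros x; eexists; apply Cderiv_duhamel, Hc. Qed.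

(** Integration by parts for [H = duhamel c psi tau]: since [H' = i c tau H + psi], the integral of
    [(H e^{-icts})'] over [[-1,1]] involves only the transforms of [psi] and [H], and the boundary
    terms vanish. *)
Lemma cfourier_duhamel (c : R) (psi : R -> R) (lam : C) (tau t : R) :
  (forall x, continuous psi x) ->
  (forall x, Cmult lam (RtoC (psi x)) = cfourier c (fun t => RtoC (psi t)) x) ->
  psi tau = 0 ->
  Cmult (Cconj lam) (RtoC (psi t)) = Cmult (0, c * (t - tau)) (cfourier (- c) (duhamel c psi tau) t).
Proof.
  intros Hc He H0. pose proof (cfourier_conj _ _ _ Hc He) as Hb.
  rewrite Hb.
  assert (Hp : Ccont (fun t => RtoC (psi t))) by (apply Ccont_RtoC; auto).
  pose proof (Ccont_duhamel c psi tau Hc) as HH.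
  assert (Z : CInt (fun s => Cplus (Cmult (RtoC (psi s)) (cis (- c * t * s)))
      (Cmult (0, c * (tau - t)) (Cmult (duhamel c psi tau s) (cis (- c * t * s))))) (-1) 1 = RtoC 0).
  { rewrite (CInt_Cderiv (fun s => Cmult (duhamel c psi tau s) (cis (- c * t * s)))).
    (* At [1] the inner integral is empty; at [-1] it is minus the transform of [psi] at [tau] with
       frequency [- c], that is [- Cconj lam * psi tau = 0]. *)
    - unfold duhamel. rewrite CInt_point.
      pose proof (CInt_Chasles (fun s => Cmult (RtoC (psi s)) (cis (- c * tau * s))) (-1) 1 (-1)
        (cfourier_integrand_cont _ _ _ Hp)) as E.
      rewrite CInt_point in E.
      specialize (Hb tau). rewrite H0 in Hb. unfold cfourier in Hb. rewrite <- Hb in E.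
      rewrite Cmult_0_r, Cplus_0_l in E. rewrite E. ring.
    - intros s. eapply Cderiv_eq; [| apply Cderiv_mult; [apply Cderiv_duhamel, Hc | apply Cderiv_cis]].
      replace (0, c * (tau - t)) with (Cplus (0, c * tau) (0, - c * t))
        by (unfold Cplus; simpl; f_equal; ring). ring.
    - apply Ccont_plus; [|apply Ccont_mult; [apply Ccont_const|]]; apply cfourier_integrand_cont; auto. }
  rewrite CInt_plus, CInt_mult_l in Z;
    try (apply Ccont_mult; [apply Ccont_const|]); try (apply cfourier_integrand_cont; auto).
  fold (cfourier (- c) (fun s => RtoC (psi s)) t) in Z. fold (cfourier (- c) (duhamel c psi tau) t) in Z.
  replace (0, c * (t - tau)) with (Copp (0, c * (tau - t)))
    by (unfold Copp; simpl; f_equal; ring).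
  set (A := cfourier (- c) (fun s => RtoC (psi s)) t) in *.
  set (B := Cmult _ (cfourier (- c) (duhamel c psi tau) t)) in Z.
  replace A with (Cplus (Cplus A B) (Copp B)) by ring. rewrite Z. unfold B. ring.
Qed.

(** A negative value at [a] would persist nearby, and punctured neighbourhoods are nonempty. This
    carries relations proved away from a root over to the root itself. *)
Lemma continuous_nonneg_locally' (f : R -> R) (a : R) :
  continuous f a -> locally' a (fun x => 0 <= f x) -> 0 <= f a.
Proof.
  intros Hf Hl. destruct (Rle_lt_dec 0 (f a)) as [h|h]; auto. exfalso.
  assert (Hn : locally a (fun x => f x < 0)).
  { apply (Hf (fun y => y < 0)). apply (open_lt 0), h. }
  assert (N : locally' a (fun _ => False)).
  { generalize Hl. unfold locally', within. intros Hl'. generalize (filter_and _ _ Hn Hl'). apply filter_imp.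
    intros x [H1 H2] Hx. specialize (H2 Hx). lra. }
  destruct (filter_ex (F := Rbar_locally' (Finite a)) _ N); auto.
Qed.

(* Equals [psi t / (t - tau)] for [t <> tau]; the integral representation makes continuity at
   [tau] immediate, without differentiating [psi]. *)
Definition divdiff (c : R) (psi : R -> R) (lam : C) (tau t : R) : R :=
  Re (Cmult (Cmult (Cinv (Cconj lam)) (0, c)) (cfourier (- c) (duhamel c psi tau) t)).

(** The complex expression whose real part is [divdiff] becomes the real number [psi t] when
    multiplied by [t - tau]. It is therefore real off [tau], and by continuity at [tau], so taking
    [Re] loses nothing. *)
Lemma divdiff_spec (c : R) (psi : R -> R) (lam : C) (tau : R) :
  (forall x, continuous psi x) ->
  lam <> RtoC 0 ->
  (forall x, Cmult lam (RtoC (psi x)) = cfourier c (fun t => RtoC (psi t)) x) ->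
  psi tau = 0 ->
  let q := divdiff c psi lam tau in
    (forall x, continuous q x) /\ (forall t, (t - tau) * q t = psi t) /\
    (forall t, Cmult (Cconj lam) (RtoC (q t)) =
               Cmult (0, c) (cfourier (- c) (duhamel c psi tau) t)).
Proof.
  intros Hc Hl He H0 q.
  assert (Hl' : Cconj lam <> RtoC 0).
  { intros E. apply Hl. rewrite <- (Cconj_conj lam), E. unfold Cconj, RtoC; simpl; f_equal; ring. }
  set (g := fun t => Cmult (Cmult (Cinv (Cconj lam)) (0, c)) (cfourier (- c) (duhamel c psi tau) t)).
  assert (Hg : Ccont g).
  { apply Ccont_mult; [apply Ccont_const | apply Ccont_cfourier, Ccont_duhamel, Hc]. }
  assert (Hd : forall t, Cmult (RtoC (t - tau)) (g t) = RtoC (psi t)).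
  { intros t. pose proof (cfourier_duhamel c psi lam tau t Hc He H0) as E.
    replace (RtoC (psi t)) with (Cmult (Cinv (Cconj lam)) (Cmult (Cconj lam) (RtoC (psi t))))
      by (field; auto).
    rewrite E. unfold g.
    replace (0, c * (t - tau)) with (Cmult (RtoC (t - tau)) (0, c))
      by (unfold Cmult, RtoC; simpl; f_equal; ring). ring. }
  assert (Hi : forall t, t <> tau -> Im (g t) = 0).
  { intros t Ht. specialize (Hd t). apply (f_equal Im) in Hd.
    assert (E : forall (r : R) (z : C), Im (Cmult (RtoC r) z) = r * Im z)
      by (intros r z; simpl; unfold Im; ring).
    rewrite E in Hd. apply (Rmult_eq_reg_l (t - tau)); [|lra].
    rewrite Hd, Rmult_0_r. reflexivity. }
  assert (Hl'' : locally' tau (fun t => Im (g t) = 0)).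
  { unfold locally', within. apply filter_forall. intros t Ht; apply Hi, Ht. }
  (* Vanishing is obtained as two inequalities, from [Im g] and from its opposite. *)
  assert (Hi0 : Im (g tau) = 0).
  { apply Rle_antisym.
    - apply Ropp_le_cancel. rewrite Ropp_0.
      apply (continuous_nonneg_locally' (fun t => - Im (g t))).
      + apply (continuous_opp (V := R_NormedModule)), (Hg tau).
      + revert Hl''. apply filter_imp. intros x ->. lra.
    - apply (continuous_nonneg_locally' (fun t => Im (g t))).
      + apply (Hg tau).
      + revert Hl''. apply filter_imp. intros x ->. lra. }
  assert (Hr : forall t, RtoC (Re (g t)) = g t).
  { intros t. destruct (Req_dec t tau) as [->|h].
    - rewrite (surjective_pairing (g tau)). unfold RtoC. f_equal; auto.
    - rewrite (surjective_pairing (g t)). unfold RtoC. f_equal. symmetry; apply (Hi t h). }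
  change q with (fun t => Re (g t)). repeat split.
  - intros x; apply (Hg x).
  - intros t. apply RtoC_inj. rewrite RtoC_mult, Hr. apply Hd.
  - intros t. rewrite Hr. unfold g. field; auto.
Qed.

(** Variation of constants: the transform [Q] of [q] satisfies [Q' = i c tau Q + i c lam psi], and
    [i c lam H] is a particular solution. The constant of integration is read off at [x = 0]. *)
Lemma cfourier_divdiff (c : R) (psi q : R -> R) (lam : C) (tau x : R) :
  (forall x, continuous psi x) -> (forall x, continuous q x) ->
  (forall x, Cmult lam (RtoC (psi x)) = cfourier c (fun t => RtoC (psi t)) x) ->
  (forall t, (t - tau) * q t = psi t) ->
  cfourier c (fun t => RtoC (q t)) x =
  Cplus (Cmult (Cmult (0, c) lam) (duhamel c psi tau x))
    (Cmult (Cplus (RtoC (RInt q (-1) 1)) (Cmult (Cmult (0, c) lam)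
       (CInt (fun s => Cmult (RtoC (psi s)) (cis (- c * tau * s))) 0 1)))
      (cis (c * tau * x))).
Proof.
  intros Hc Hq He Hd.
  assert (Hp : Ccont (fun t => RtoC (psi t))) by (apply Ccont_RtoC; auto).
  assert (HqC : Ccont (fun t => RtoC (q t))) by (apply Ccont_RtoC; auto).
  set (G := fun x => CInt (fun s => Cmult (RtoC (psi s)) (cis (- c * tau * s))) 1 x).
  (* The integrating factor [e^{-ic tau x}] turns the equation into the constancy of [D]. *)
  set (D := fun x => Cplus (Cmult (cis (- c * tau * x)) (cfourier c (fun t => RtoC (q t)) x))
                (Cmult (Cmult (Copp (0, c)) lam) (G x))).
  assert (HD : forall z, Cderiv D z (RtoC 0)).
  { intros z. unfold D. eapply Cderiv_eq; [|apply Cderiv_plus; apply Cderiv_mult;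
      [apply Cderiv_cis | apply Cderiv_cfourier, HqC | apply Cderiv_const |
       apply Cderiv_CInt, cfourier_integrand_cont; auto]].
    cbv beta.
    (* Writing [y q y = (y - tau) q y + tau q y] produces [psi y] in the first term, whose transform
       is [lam * psi]. *)
    assert (E : cfourier c (fun y => Cmult (0, c * y) (RtoC (q y))) z =
      Cplus (Cmult (Cmult (0, c) lam) (RtoC (psi z))) (Cmult (0, c * tau) (cfourier c (fun t => RtoC (q t)) z))).
    { rewrite <- Cmult_assoc, He. unfold cfourier. rewrite <- !CInt_mult_l by (apply cfourier_integrand_cont; auto).
      rewrite <- CInt_plus by (apply Ccont_mult; [apply Ccont_const | apply cfourier_integrand_cont; auto]).
      apply CInt_ext; intros y. rewrite <- Hd.
      replace (0, c * y) with (Cmult (0, c) (RtoC y)) by (unfold Cmult, RtoC; simpl; f_equal; ring).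
      replace (0, c * tau) with (Cmult (0, c) (RtoC tau)) by (unfold Cmult, RtoC; simpl; f_equal; ring).
      rewrite RtoC_mult, RtoC_minus. ring. }
    rewrite E.
    replace (0, - c * tau) with (Copp (0, c * tau)) by (unfold Copp; simpl; f_equal; ring).
    ring. }
  pose proof (Cderiv_zero_const D x 0 HD) as E. unfold D in E.
  replace (- c * tau * 0) with 0 in E by ring. rewrite cis_0, Cmult_1_l in E.
  replace (cfourier c (fun t => RtoC (q t)) 0) with (RtoC (RInt q (-1) 1)) in E.
  2:{ unfold cfourier. rewrite <- CInt_RtoC. apply CInt_ext; intros y.
      replace (c * 0 * y) with 0 by ring. rewrite cis_0. ring. }
  (* [G] is based at [1], whereas the constant is stated with the integral from [0] to [1], which is
     [Psi 1 tau] in the theorem. *)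
  assert (EG : CInt (fun s => Cmult (RtoC (psi s)) (cis (- c * tau * s))) 0 1 = Copp (G 0)).
  { pose proof (CInt_Chasles (fun s => Cmult (RtoC (psi s)) (cis (- c * tau * s))) 1 0 1
        (cfourier_integrand_cont _ _ _ Hp)) as E'. rewrite CInt_point in E'.
    fold (G 0) in E'.
    match goal with |- ?A = _ => replace A with (Cplus (Cplus (G 0) A) (Copp (G 0))) by ring end.
    rewrite E'. ring. }
  rewrite EG. unfold duhamel. fold (G x).
  pose proof (cis_opp_l (c * tau * x)) as E1.
  replace (- c * tau * x) with (- (c * tau * x)) in E by ring.
  set (F := cfourier c (fun t => RtoC (q t)) x) in *.
  transitivity (Cmult (Cplus (Cmult (cis (- (c * tau * x))) F) (Cmult (Cmult (Copp (0, c)) lam) (G x))) (cis (c * tau * x)) + Cmult (Cmult (0, c) lam) (G x) * cis (c * tau * x))%C.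
  { transitivity (Cmult F (Cmult (cis (- (c * tau * x))) (cis (c * tau * x)))); [rewrite E1 | ]; ring. }
  rewrite E. ring.
Qed.

(** [Q] paired with [phi] gives one relation between [J] and the pairing [B] of [phi] with [H]; the
    formula for [Cconj lam * q] gives another. Eliminating [B] leaves the identity for [J]. *)
Lemma divdiff_moment (c : R) (psi phi q : R -> R) (lam mu : C) (tau : R) :
  (forall x, continuous psi x) -> (forall x, continuous phi x) -> (forall x, continuous q x) ->
  (forall x, Cmult lam (RtoC (psi x)) = cfourier c (fun t => RtoC (psi t)) x) ->
  (forall x, Cmult mu (RtoC (phi x)) = cfourier c (fun t => RtoC (phi t)) x) ->
  mu <> RtoC 0 ->
  (forall t, (t - tau) * q t = psi t) ->
  (forall t, Cmult (Cconj lam) (RtoC (q t)) = Cmult (0, c) (cfourier (- c) (duhamel c psi tau) t)) ->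
  Cmult (RtoC (1 - Cmod lam ^ 2 / Cmod mu ^ 2)) (RtoC (RInt (fun t => q t * phi t) (-1) 1)) =
  Cmult (RtoC (phi tau)) (Cplus (RtoC (RInt q (-1) 1)) (Cmult (Cmult (0, c) lam)
       (CInt (fun s => Cmult (RtoC (psi s)) (cis (- c * tau * s))) 0 1))).
Proof.
  intros Hc Hc' Hq He He' Hmu Hd HF.
  set (K := Cplus (RtoC (RInt q (-1) 1)) _).
  set (J := RtoC (RInt (fun t => q t * phi t) (-1) 1)).
  assert (HqC : Ccont (fun t => RtoC (q t))) by (apply Ccont_RtoC; auto).
  assert (HpC : Ccont (fun t => RtoC (phi t))) by (apply Ccont_RtoC; auto).
  pose proof (Ccont_duhamel c psi tau Hc) as HH.
  assert (HJ : J = CInt (fun t => Cmult (RtoC (q t)) (RtoC (phi t))) (-1) 1).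
  { unfold J. rewrite <- CInt_RtoC. apply CInt_ext; intros; apply RtoC_mult. }
  (* First relation: [mu J = i c lam B + K mu phi(tau)]. *)
  pose proof (cfourier_symm c _ _ HpC HqC) as S1.
  rewrite (CInt_ext (fun y => Cmult (RtoC (q y)) (cfourier c (fun x => RtoC (phi x)) y))
     (fun y => Cmult mu (Cmult (RtoC (q y)) (RtoC (phi y))))) in S1
    by (intros; rewrite <- He'; ring).
  rewrite CInt_mult_l, <- HJ in S1 by (apply Ccont_mult; auto).
  rewrite (CInt_ext _ (fun x => Cplus (Cmult (Cmult (0, c) lam) (Cmult (RtoC (phi x)) (duhamel c psi tau x)))
     (Cmult K (Cmult (RtoC (phi x)) (cis (c * tau * x)))))) in S1.
  2:{ intros x. rewrite (cfourier_divdiff c psi q lam tau x) by auto. fold K. ring. }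
  rewrite CInt_plus in S1
   by (apply Ccont_mult; [apply Ccont_const | apply Ccont_mult; auto; apply Ccont_cis]).
  rewrite !CInt_mult_l in S1 by (apply Ccont_mult; auto; apply Ccont_cis).
  fold (cfourier c (fun x => RtoC (phi x)) tau) in S1. rewrite <- He' in S1.
  (* Second relation, with the adjoint transform and after multiplication by [i c]:
     [i c (Cconj mu) B = (Cconj lam) J]. *)
  pose proof (cfourier_symm (- c) _ _ HH HpC) as S2.
  rewrite (CInt_ext (fun x => Cmult (duhamel c psi tau x) _)
     (fun y => Cmult (Cconj mu) (Cmult (RtoC (phi y)) (duhamel c psi tau y)))) in S2
    by (intros; rewrite <- (cfourier_conj c phi mu) by auto; ring).
  rewrite CInt_mult_l in S2 by (apply Ccont_mult; auto).
  apply (f_equal (Cmult (0, c))) in S2.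
  rewrite <- (CInt_mult_l (0, c) (fun y => Cmult (RtoC (phi y)) (cfourier (- c) (duhamel c psi tau) y))) in S2
    by (apply Ccont_mult; auto; apply Ccont_cfourier; auto).
  rewrite (CInt_ext (fun y => Cmult (0, c) (Cmult (RtoC (phi y)) (cfourier (- c) (duhamel c psi tau) y)))
     (fun y => Cmult (Cconj lam) (Cmult (RtoC (q y)) (RtoC (phi y))))) in S2.
  2:{ intros y. transitivity (Cmult (RtoC (phi y)) (Cmult (0, c) (cfourier (- c) (duhamel c psi tau) y))); [ring|].
      rewrite <- HF. ring. }
  rewrite CInt_mult_l, <- HJ in S2 by (apply Ccont_mult; auto).
  set (B := CInt (fun x => Cmult (RtoC (phi x)) (duhamel c psi tau x)) (-1) 1) in *.
  pose proof (proj1 (Cmod_gt_0 mu) Hmu) as Hm.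
  assert (Hm2 : RtoC (Cmod mu ^ 2) <> RtoC 0) by (intros E; apply RtoC_inj in E; nra).
  assert (T : Cmult (Cmult mu (Cconj mu)) J =
     Cplus (Cmult (Cmult lam (Cconj lam)) J) (Cmult (Cmult mu (Cconj mu)) (Cmult K (RtoC (phi tau))))).
  { transitivity (Cmult (Cconj mu) (Cmult mu J)); [ring|]. rewrite <- S1.
    transitivity (Cplus (Cmult lam (Cmult (0, c) (Cmult (Cconj mu) B)))
       (Cmult (Cmult mu (Cconj mu)) (Cmult K (RtoC (phi tau))))); [ring|]. rewrite S2. ring. }
  rewrite !Cmod_sqr_conj in T.
  rewrite RtoC_minus, RtoC_div by nra.
  transitivity (Cmult (Cinv (RtoC (Cmod mu ^ 2))) (Cminus (Cmult (RtoC (Cmod mu ^ 2)) J) (Cmult (RtoC (Cmod lam ^ 2)) J))).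
  { field; auto. }
  rewrite T. field; auto.
Qed.

(** * Exceptional points, finite sums and an integral bound *)

(** Extensionality compares integrands only on open intervals, so splitting at [p] makes the value
    there irrelevant. This absorbs the division by zero at the pole in [W]. *)
Lemma RInt_ext_off_point (f g : R -> R) (a b p : R) :
  (forall x, continuous f x) -> a < p < b -> (forall x, x <> p -> f x = g x) ->
  RInt g a b = RInt f a b.
Proof.
  intros Hf Hp E. apply is_RInt_unique.
  rewrite <- (RInt_Chasles (V := R_CompleteNormedModule) f a p b) by (apply ex_RInt_cont; auto).
  apply (is_RInt_Chasles (V := R_NormedModule) g a p b);
    (apply (is_RInt_ext f); [|apply (RInt_correct (V := R_CompleteNormedModule)), ex_RInt_cont; auto]);
    intros x Hx; apply E; rewrite Rmin_left, Rmax_right in Hx; lra.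
Qed.

Lemma continuous_rsum (n : nat) (f : nat -> R -> R) (x : R) :
  (forall j, (j < n)%nat -> continuous (f j) x) ->
  continuous (fun u => rsum n (fun j => f j u)) x.
Proof.
  induction n as [|n IH]; intros Hf; simpl; [apply continuous_const|].
  apply (continuous_plus (V := R_NormedModule)); auto.
Qed.

Lemma rsum_ext (n : nat) (f g : nat -> R) :
  (forall j, (j < n)%nat -> f j = g j) -> rsum n f = rsum n g.
Proof. induction n as [|n IH]; intros E; simpl; auto. rewrite IH, E; auto. Qed.

Lemma rsum_mult_l (n : nat) (k : R) (f : nat -> R) : rsum n (fun j => k * f j) = k * rsum n f.
Proof. induction n as [|n IH]; simpl; [|rewrite IH]; ring. Qed.

Lemma RInt_rsum (n : nat) (f : nat -> R -> R) (a b : R) :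
  (forall j x, (j < n)%nat -> continuous (f j) x) ->
  RInt (fun x => rsum n (fun j => f j x)) a b = rsum n (fun j => RInt (f j) a b).
Proof.
  induction n as [|n IH]; intros Hf; simpl.
  - rewrite RInt_const. unfold scal; simpl; unfold mult; simpl; ring.
  - rewrite <- IH by auto. apply (RInt_plus (V := R_CompleteNormedModule)); apply ex_RInt_cont;
    [intros; apply continuous_rsum; auto | auto].
Qed.

(** Each point is either the centre, which is already removed, or lies in the complement of an open
    neighbourhood of [x]; finitely many such conditions intersect. *)
Lemma locally'_avoid (n : nat) (t : nat -> R) (x : R) :
  locally' x (fun y => forall j, (j < n)%nat -> y <> t j).
Proof.
  induction n as [|n IH].
  - apply filter_forall; intros; lia.
  - assert (H : locally' x (fun y => y <> t n)).
    { destruct (Req_dec x (t n)) as [->|h].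
      - unfold locally', within. apply filter_forall; auto.
      - unfold locally', within. apply filter_imp with (fun y => y <> t n); auto.
        apply (open_neq (t n)), h. }
    generalize (filter_and _ _ IH H). apply filter_imp. intros y [H1 H2] j Hj.
    destruct (Nat.eq_dec j n) as [->|]; auto. apply H1; lia.
Qed.

Lemma Cmod_antitone (lam : nat -> C) (m n : nat) :
  (forall k, Cmod (lam (S k)) <= Cmod (lam k)) -> (m <= n)%nat -> Cmod (lam n) <= Cmod (lam m).
Proof. intros H; induction 1; [lra|]. eapply Rle_trans; [apply H|auto]. Qed.

(* AM-GM replaces Cauchy-Schwarz, since both factors are normalized. *)
Lemma RInt_weighted_product_bound (f phi psi : R -> R) (a b M : R) :
  a <= b -> 0 <= M ->
  (forall x, continuous f x) -> (forall x, continuous phi x) -> (forall x, continuous psi x) ->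
  RInt (fun x => phi x * phi x) a b = 1 -> RInt (fun x => psi x * psi x) a b = 1 ->
  (forall x, a < x < b -> Rabs (f x) <= M * Rabs (phi x * psi x)) ->
  Rabs (RInt f a b) <= M.
Proof.
  intros Hab HM Hf Hphi Hpsi N1 N2 HB.
  assert (C1 : forall x, continuous (fun x => phi x * phi x) x)
    by (intros; apply (continuous_mult (K := R_AbsRing)); auto).
  assert (C2 : forall x, continuous (fun x => psi x * psi x) x)
    by (intros; apply (continuous_mult (K := R_AbsRing)); auto).
  assert (E : RInt (fun x => M / 2 * (phi x * phi x + psi x * psi x)) a b = M).
  { rewrite (RInt_scal (V := R_CompleteNormedModule) (fun x => phi x * phi x + psi x * psi x)).
    - rewrite (RInt_plus (V := R_CompleteNormedModule) (fun x => phi x * phi x)) by (apply ex_RInt_cont; auto).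
      rewrite N1, N2. unfold scal, plus; simpl; unfold mult; simpl; lra.
    - apply (ex_RInt_plus (V := R_NormedModule)); apply ex_RInt_cont; auto. }
  rewrite <- E. eapply Rle_trans; [apply abs_RInt_le; auto; apply ex_RInt_cont; auto|].
  apply RInt_le; auto.
  - apply ex_RInt_cont. intros; apply (continuous_comp f Rabs); auto. apply continuous_Rabs.
  - apply ex_RInt_cont. intros.
    apply (continuous_mult (K := R_AbsRing)); [apply continuous_const|].
    apply (continuous_plus (V := R_NormedModule)); auto.
  - intros x Hx. eapply Rle_trans; [apply HB; auto|].
    replace (M / 2 * (phi x * phi x + psi x * psi x)) with (M * ((phi x * phi x + psi x * psi x) / 2)) by field.
    apply Rmult_le_compat_l; auto. apply Rabs_le.
    pose proof (pow2_ge_0 (phi x + psi x)). pose proof (pow2_ge_0 (phi x - psi x)). split; nra.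
Qed.

(** * The error bound for the quadrature at the roots of [psi n] *)

Theorem theorem60 (c : R) (lam : nat -> C) (psi : nat -> R -> R) (n m : nat) (t : nat -> R) :
  0 < c -> is_PSWF_system c lam psi ->
  (0 < n)%nat -> (m <= n - 1)%nat ->
  (* t 0 < ... < t (n-1) are exactly the roots of psi_n in (-1,1) *)
  (forall j, (j < n)%nat -> -1 < t j < 1 /\ psi n (t j) = 0) ->
  (forall j k, (j < k)%nat -> (k < n)%nat -> t j < t k) ->
  (forall s, -1 < s < 1 -> psi n s = 0 -> exists j, (j < n)%nat /\ s = t j) ->
  let W (j : nat) : R :=
    / Derive (psi n) (t j) * RInt (fun s => psi n s / (s - t j)) (-1) 1 in
  let Psi (y tau : R) : C :=
    @RInt C_R_CompleteNormedModule
      (fun x => Cmult (RtoC (psi n x)) (cis (- (c * x * tau)))) 0 y in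
  let P : C :=
    csum n (fun j => Cmult (RtoC (psi m (t j) / Derive (psi n) (t j))) (Psi 1 (t j))) in
  let I (tau : R) : R :=
    / psi n tau - rsum n (fun j => / (Derive (psi n) (t j) * (tau - t j))) in
  let Inorm : Rbar :=
    Lub_Rbar (fun r => exists tau, -1 < tau < 1 /\ psi n tau <> 0 /\ r = Rabs (I tau)) in
  Rbar_le
    (Finite (Rabs (RInt (psi m) (-1) 1 - rsum n (fun j => psi m (t j) * W j))))
    (Rbar_plus
       (Rbar_mult (Finite (1 - (Cmod (lam n)) ^ 2 / (Cmod (lam m)) ^ 2)) Inorm)
       (Finite (Cmod (lam n) *
          (Cmod (lam n) / Cmod (lam m) * Rabs (psi m 0%R) + c * Cmod P)))).
Proof.
  intros Hc [Hcont [Hlam [Heig [Hon [_ Hdec]]]]] Hn Hmn Ht Hord Hroots W Psi P I Inorm.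
  assert (He : forall k x, Cmult (lam k) (RtoC (psi k x)) = cfourier c (fun s => RtoC (psi k s)) x).
  { intros k x. rewrite Heig. apply RInt_C_CInt, cfourier_integrand_cont, Ccont_RtoC; auto. }
  set (a := fun j => / Derive (psi n) (t j)).
  set (q := fun j => divdiff c (psi n) (lam n) (t j)).
  assert (Hq : forall j, (j < n)%nat -> (forall x, continuous (q j) x) /\
    (forall s, (s - t j) * q j s = psi n s) /\
    (forall s, Cmult (Cconj (lam n)) (RtoC (q j s)) =
               Cmult (0, c) (cfourier (- c) (duhamel c (psi n) (t j)) s))).
  { intros j Hj.
    exact (divdiff_spec c (psi n) (lam n) (t j) (Hcont n) (Hlam n) (He n) (proj2 (Ht j Hj))). }
  set (J := fun j => RInt (fun s => q j s * psi m s) (-1) 1).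
  set (w := fun j => RInt (q j) (-1) 1).
  set (rho := 1 - (Cmod (lam n)) ^ 2 / (Cmod (lam m)) ^ 2).
  assert (HJ : forall j, (j < n)%nat -> Cmult (RtoC rho) (RtoC (J j)) =
     Cmult (RtoC (psi m (t j))) (Cplus (RtoC (w j)) (Cmult (Cmult (0, c) (lam n)) (Psi 1 (t j))))).
  { intros j Hj. destruct (Hq j Hj) as [q1 [q2 q3]].
    unfold rho, J, w.
    rewrite (divdiff_moment c (psi n) (psi m) (q j) (lam n) (lam m) (t j)); auto.
    do 3 f_equal. unfold Psi.
    assert (E : forall x, Cmult (RtoC (psi n x)) (cis (- c * t j * x)) =
                          Cmult (RtoC (psi n x)) (cis (- (c * x * t j))))
      by (intros x; do 2 f_equal; ring).
    rewrite RInt_C_CInt; [apply CInt_ext, E|].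
    eapply Ccont_ext; [apply E|]. apply cfourier_integrand_cont, Ccont_RtoC; auto. }
  assert (HW : forall j, (j < n)%nat -> W j = a j * w j).
  { intros j Hj. destruct (Hq j Hj) as [q1 [q2 q3]]. unfold W, a, w. f_equal.
    apply RInt_ext_off_point with (t j); auto; [apply Ht; auto|].
    intros x Hx. rewrite <- (q2 x). field; lra. }
  (* The moment identities are summed with weights [a j]; the induction runs over partial sums
     [k <= n] because [HJ] and [HW] hold only for genuine roots. *)
  assert (Hsum : forall k, (k <= n)%nat ->
    RtoC (rsum k (fun j => psi m (t j) * W j)) =
    Cminus (Cmult (RtoC rho) (RtoC (rsum k (fun j => a j * J j))))
      (Cmult (Cmult (0, c) (lam n))
        (csum k (fun j => Cmult (RtoC (psi m (t j) / Derive (psi n) (t j))) (Psi 1 (t j)))))).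
  { induction k as [|k IH]; intros Hk; simpl; [ring|].
    rewrite !RtoC_plus, IH by lia. rewrite HW by lia.
    unfold Rdiv. fold (a k). rewrite !RtoC_mult.
    specialize (HJ k Hk).
    transitivity (Cplus (Cmult (RtoC rho) (RtoC (rsum k (fun j => a j * J j))))
       (Cplus (Copp (Cmult (Cmult (0, c) (lam n))
         (csum k (fun j => Cmult (RtoC (psi m (t j) * / Derive (psi n) (t j))) (Psi 1 (t j))))))
       (Cminus (Cmult (RtoC (a k)) (Cmult (RtoC rho) (RtoC (J k))))
        (Cmult (Cmult (0, c) (lam n)) (Cmult (Cmult (RtoC (psi m (t k))) (RtoC (a k))) (Psi 1 (t k))))))).
    - rewrite HJ. unfold Rdiv. ring.
    - ring. }
  specialize (Hsum n (le_n n)). fold P in Hsum.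
  (* [g] is the continuous extension of [I * psi m * psi n] across the roots, where [I] itself is
     undefined. *)
  set (g := fun x => psi m x - rsum n (fun j => a j * (q j x * psi m x))).
  assert (Hqm : forall j x, (j < n)%nat -> continuous (fun x => q j x * psi m x) x).
  { intros j x Hj. apply (continuous_mult (K := R_AbsRing)); auto. apply (Hq j Hj). }
  assert (Haqm : forall j x, (j < n)%nat -> continuous (fun x => a j * (q j x * psi m x)) x).
  { intros j x Hj. apply (continuous_mult (K := R_AbsRing)); auto. apply continuous_const. }
  assert (Hgc : forall x, continuous g x).
  { intros x. apply (continuous_minus (V := R_NormedModule)); auto. 
    apply (continuous_rsum n (fun j x => a j * (q j x * psi m x))); auto. }
  assert (HG : RInt g (-1) 1 = RInt (psi m) (-1) 1 - rsum n (fun j => a j * J j)).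
  { unfold g. 
    etransitivity; [apply (RInt_minus (V := R_CompleteNormedModule)); apply ex_RInt_cont; auto;
      intros x; apply (continuous_rsum n (fun j x => a j * (q j x * psi m x))); auto|].
    unfold minus, plus, opp; simpl. unfold Rminus. do 2 f_equal.
    rewrite (RInt_rsum n (fun j x => a j * (q j x * psi m x))) by auto.
    apply rsum_ext; intros j Hj. 
    apply (RInt_scal (V := R_CompleteNormedModule) (fun x => q j x * psi m x)). apply ex_RInt_cont; auto. }
  (* The eigenvalue equation at [0], where the exponential is 1. *)
  assert (H0 : RtoC (RInt (psi m) (-1) 1) = Cmult (lam m) (RtoC (psi m 0))).
  { rewrite He, <- CInt_RtoC. unfold cfourier. apply CInt_ext; intros x.
    replace (c * 0 * x) with 0 by ring. rewrite cis_0. ring. }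
  pose proof (proj1 (Cmod_gt_0 _) (Hlam m)) as Lm. pose proof (proj1 (Cmod_gt_0 _) (Hlam n)) as Ln.
  assert (Hrho : 0 <= rho).
  { assert (Hle : Cmod (lam n) <= Cmod (lam m)) by (apply Cmod_antitone; auto; lia).
    unfold rho. apply -> Rminus_le_0. apply Rmult_le_reg_r with (Cmod (lam m) ^ 2); [nra|].
    unfold Rdiv. rewrite Rmult_assoc, Rinv_l, Rmult_1_r, Rmult_1_l by nra. nra. }
  assert (Hmain : Rabs (RInt (psi m) (-1) 1 - rsum n (fun j => psi m (t j) * W j)) <=
     rho * Rabs (RInt g (-1) 1) + Cmod (lam n) *
          (Cmod (lam n) / Cmod (lam m) * Rabs (psi m 0%R) + c * Cmod P)).
  { rewrite <- Cmod_R, RtoC_minus, Hsum.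
    (* The error splits as [rho * int g + (1 - rho) * int psi_m + i c lam_n P]; the triangle
       inequality then gives the three terms of the bound. *)
    replace (Cminus _ _) with (Cplus (Cplus (RtoC (rho * RInt g (-1) 1))
       (Cmult (RtoC (1 - rho)) (RtoC (RInt (psi m) (-1) 1)))) (Cmult (Cmult (0, c) (lam n)) P)).
    2:{ rewrite HG, RtoC_mult, !RtoC_minus. ring. }
    eapply Rle_trans; [apply Cmod_triangle|].
    eapply Rle_trans; [apply Rplus_le_compat_r, Cmod_triangle|].
    rewrite H0, !Cmod_mult, !Cmod_R, Rabs_mult, (Rabs_pos_eq rho) by auto.
    replace (Cmod (0, c)) with c
      by (unfold Cmod; simpl; replace (0 * (0 * 1) + c * (c * 1)) with (c * c) by ring;
          rewrite sqrt_square; lra).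
    unfold rho at 2. rewrite (Rabs_pos_eq (1 - _)).
    - right. field. lra.
    - replace (1 - (1 - Cmod (lam n) ^ 2 / Cmod (lam m) ^ 2)) with ((Cmod (lam n) / Cmod (lam m)) ^ 2) by (field; lra).
      apply pow2_ge_0. }
  (* Off the roots this is the factorization [g = I * psi m * psi n]; at a root it follows by
     continuity from a punctured neighbourhood free of roots. *)
  assert (Hsup : forall M, (forall x, -1 < x < 1 -> psi n x <> 0 -> Rabs (I x) <= M) -> 
     forall x, -1 < x < 1 -> Rabs (g x) <= M * Rabs (psi m x * psi n x)).
  { intros M HM.
    assert (Hnz : forall x, -1 < x < 1 -> psi n x <> 0 -> Rabs (g x) <= M * Rabs (psi m x * psi n x)).
    { intros x Hx Hp. replace (g x) with (I x * (psi m x * psi n x)).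
      - rewrite Rabs_mult. apply Rmult_le_compat_r; [apply Rabs_pos|auto].
      - unfold I, g. rewrite (rsum_ext n (fun j => a j * (q j x * psi m x))
          (fun j => (psi m x * psi n x) * / (Derive (psi n) (t j) * (x - t j)))).
        + rewrite rsum_mult_l. field; auto.
        (* Inverting the product is valid under the convention [/ 0 = 0]; for the cancellation only
           [x - t j] has to be shown nonzero. *)
        + intros j Hj. destruct (Hq j Hj) as [_ [q2 _]]. unfold a. rewrite Rinv_mult.
          assert (x - t j <> 0).
          { intros E. apply Hp. rewrite <- (q2 x), E. ring. }
          rewrite <- (q2 x). set (d := / Derive (psi n) (t j)). field; auto. }
    intros x Hx. destruct (Req_dec (psi n x) 0) as [Hp|Hp]; [|auto].
    apply <- Rminus_le_0.
    apply (continuous_nonneg_locally' (fun x => M * Rabs (psi m x * psi n x) - Rabs (g x))).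
    - apply (continuous_minus (V := R_NormedModule)).
      + apply (continuous_mult (K := R_AbsRing)); [apply continuous_const|].
        apply (continuous_comp (fun x => psi m x * psi n x) Rabs); [|apply continuous_Rabs].
        apply (continuous_mult (K := R_AbsRing)); auto.
      + apply (continuous_comp g Rabs); auto. apply continuous_Rabs.
    - assert (Ho : locally x (fun y => -1 < y < 1)).
      { apply (open_and _ _ (open_gt (-1)) (open_lt 1)); auto. }
      assert (Ho' : locally' x (fun y => -1 < y < 1)).
      { unfold locally', within. revert Ho. apply filter_imp; auto. }
      generalize (filter_and _ _ Ho' (locally'_avoid n t x)). apply filter_imp.
      intros y [Hy Hy']. apply -> Rminus_le_0. apply Hnz; auto.
      intros E. destruct (Hroots y Hy E) as [j [Hj Ej]]. apply (Hy' j Hj Ej). }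
  destruct (Lub_Rbar_correct (fun r => exists tau, -1 < tau < 1 /\ psi n tau <> 0 /\ r = Rabs (I tau)))
    as [Hub _]. fold Inorm in Hub.
  (* A point that is not a root makes the set under the supremum nonempty, so [Inorm] is nonnegative
     and differs from [m_infty]. *)
  assert (Hne : exists tau, -1 < tau < 1 /\ psi n tau <> 0).
  { assert (Ho : locally' 0 (fun y => -1 < y < 1)).
    { unfold locally', within. apply filter_imp with (fun y => -1 < y < 1); auto.
      apply (open_and _ _ (open_gt (-1)) (open_lt 1)); lra. }
    destruct (filter_ex (F := Rbar_locally' (Finite 0)) _
      (filter_and _ _ Ho (locally'_avoid n t 0))) as [y [Hy Hy']].
    exists y; split; auto. intros E. destruct (Hroots y Hy E) as [j [Hj Ej]]. apply (Hy' j Hj Ej). }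
  destruct Hne as [x0 [Hx0 Hp0]].
  assert (HI : forall x, -1 < x < 1 -> psi n x <> 0 -> Rbar_le (Rabs (I x)) Inorm)
    by (intros x Hx Hp; apply Hub; exists x; auto).
  fold rho.
  destruct Inorm as [M| |] eqn:EM.
  - simpl. eapply Rle_trans; [apply Hmain|]. apply Rplus_le_compat_r, Rmult_le_compat_l; auto.
    apply (RInt_weighted_product_bound g (psi m) (psi n)); auto; try lra.
    + eapply Rle_trans; [apply Rabs_pos|]. apply (HI x0 Hx0 Hp0).
    + rewrite Hon, Nat.eqb_refl; auto.
    + rewrite Hon, Nat.eqb_refl; auto.
  (* For infinite [Inorm], [Rbar_mult] sets [0 * p_infty = 0]; when [rho = 0] the finite bound
     [Hmain] is thus already the claim, and when [rho > 0] the right side is [p_infty]. *)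
  - destruct (Req_dec rho 0) as [Hr|Hr].
    + rewrite Hr in *. rewrite Rbar_mult_0_l. simpl. lra.
    + replace (Rbar_mult rho p_infty) with p_infty; [exact Logic.I|].
      symmetry. apply is_Rbar_mult_unique. apply is_Rbar_mult_sym, is_Rbar_mult_p_infty_pos. simpl; lra.
  - destruct (HI x0 Hx0 Hp0).
Qed.
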